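(* Let $G$ be a pure $\kappa$-sparse gapset with genus $g$ and depth $q$. If $2g \leq 3\kappa$, then $q \leq 3$.
   Context: $\mathbb{N}$ denotes the positive integers. A gapset is a finite set $G \subset \mathbb{N}$ such that whenever $z \in G$ and $z = x+y$ with $x,y \in \mathbb{N}$, then $x \in G$ or $y \in G$. The genus of $G$ is its cardinality $g$; we write $G = \{\ell_1 < \ell_2 < \cdots < \ell_g\}$. The multiplicity is $m(G) := \min\{s \in \mathbb{N} : s \notin G\}$; the conductor $c(G)$ is the least $s$ such that $s+n \notin G$ for all integers $n \geq 0$ (so $c(G) = \ell_g+1$ for $G \ne \emptyset$, and $c(\emptyset)=0$); the depth is $q(G) := \lceil c(G)/m(G) \rceil$. For $g \geq 2$, $G$ is pure $\kappa$-sparse if $\ell_{i+1}-\ell_i \leq \kappa$ for all $i \in \{1,\dots,g-1\}$ and $\ell_{i+1}-\ell_i = \kappa$ for some $i$. By convention, $\emptyset$ is pure $0$-sparse and $\{1\}$ is pure $1$-sparse (and for no other value of the parameter). *)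

(* Defs.v *)
From mathcomp Require Import all_boot all_order all_algebra.
From mathcomp Require Import finmap boolp.

Set Implicit Arguments.
Unset Strict Implicit.
Unset Printing Implicit Defensive.

Local Open Scope fset_scope.
Local Open Scope nat_scope.

(* A gapset consists of positive integers, whence 0 \notin G. *)
Definition gapset (G : {fset nat}) : Prop :=
  0 \notin G /\
  forall x y : nat, 0 < x -> 0 < y -> x + y \in G -> x \in G \/ y \in G.

Definition genus (G : {fset nat}) : nat := #|` G|.

(* The i-th smallest element of G, with 1 <= i <= genus G (i starts at 1). *)
Definition gap (G : {fset nat}) (i : nat) : nat := nth 0 (sort leq G) i.-1.

Lemma notin_fset_large (G : {fset nat}) :
  exists b : nat, forall n : nat, b + n \notin G.
Proof.
exists (\sum_(x <- G) x).+1 => n; apply/negP => bnG.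
have : (\sum_(x <- G) x).+1 + n <= \sum_(x <- G) x.
  by rewrite {2}(big_rem _ bnG) leq_addr.
by rewrite leqNgt addSn ltnS leq_addr.
Qed.

Lemma multiplicity_ex (G : {fset nat}) :
  exists s : nat, (0 < s) && (s \notin G).
Proof.
have [b bG] := notin_fset_large G.
by exists (b + 1); rewrite bG addn1.
Qed.

Definition multiplicity (G : {fset nat}) : nat := ex_minn (multiplicity_ex G).

Lemma conductor_ex (G : {fset nat}) :
  exists s : nat, `[< forall n : nat, s + n \notin G >].
Proof. by have [b bG] := notin_fset_large G; exists b; apply/asboolP. Qed.

(* s ranges over the nonnegative integers, so the empty set has conductor 0. *)
Definition conductor (G : {fset nat}) : nat := ex_minn (conductor_ex G).

Definition depth (G : {fset nat}) : int :=
  Num.ceil ((conductor G)%:R / (multiplicity G)%:R : rat)%R.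

(* Since gap G is increasing, the truncated differences below are exact. *)
Definition pure_sparse (kappa : nat) (G : {fset nat}) : Prop :=
  [\/ G = fset0 /\ kappa = 0,
      G = [fset 1] /\ kappa = 1
    | [/\ 2 <= genus G,
          forall i : nat, 1 <= i <= genus G - 1 ->
            gap G i.+1 - gap G i <= kappa
        & exists2 i : nat, 1 <= i <= genus G - 1 &
            gap G i.+1 - gap G i = kappa]].

(* Main.v *)
Require Import Defs.
From mathcomp Require Import all_boot all_order all_algebra.
From mathcomp Require Import finmap.
From mathcomp Require Import boolp zify.

(** Let [m] be the multiplicity and [c] the conductor of [G].  Since [c - 1] is a
    gap, [x] or [c - 1 - x] is a gap for every [x < c], so [c <= 2 g].  A gap
    [b > m] yields the gap [b - m], so consecutive gaps differ by at most [m] and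
    [kappa <= m].  Hence [c <= 2 g <= 3 kappa <= 3 m]. *)

Import GRing.Theory Num.Theory.

Lemma multiplicity_gt0 (G : {fset nat}) : 0 < multiplicity G.
Proof. by rewrite /multiplicity; case: ex_minnP => m /andP[]. Qed.

Lemma multiplicity_notin (G : {fset nat}) : multiplicity G \notin G.
Proof. by rewrite /multiplicity; case: ex_minnP => m /andP[]. Qed.

Lemma pred_conductor_in (G : {fset nat}) :
  0 < conductor G -> (conductor G).-1 \in G.
Proof.
rewrite /conductor; case: ex_minnP => -[//|l] /asboolP lG min_l _ /=.
apply/negPn/negP => l_notin.
(* If [l] were not a gap, [l] would already satisfy the property of which [l.+1] is the least
   witness. *)
suff: l.+1 <= l by rewrite ltnn.
apply: min_l; apply/asboolP => -[|n]; first by rewrite addn0.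
by rewrite addnS -addSn.
Qed.

Lemma gapset_compl (G : {fset nat}) (l x : nat) :
  gapset G -> l \in G -> x <= l -> x \in G \/ l - x \in G.
Proof.
move=> [_ addG] lG le_xl.
(* [addG] needs positive summands; when one is 0, the other is the gap [l] itself. *)
have [->|x_gt0] := posnP x; first by rewrite subn0; right.
have [lx0|lx_gt0] := posnP (l - x).
  by left; have -> : x = l by lia.
by apply: addG => //; rewrite subnKC.
Qed.

Lemma conductor_le_double_genus (G : {fset nat}) :
  gapset G -> conductor G <= 2 * genus G.
Proof.
move=> hG; have [->//|c_gt0] := posnP (conductor G).
have lG := pred_conductor_in G c_gt0; set l := _.-1 in lG.
(* Counting: [conductor G] distinct numbers lie in a list of length [2 * genus G], namely [G]
   followed by its reflection in [l]. *)
have sub : {subset iota 0 (conductor G) <= G ++ [seq l - x | x <- G]}.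
  move=> x; rewrite mem_iota add0n => /andP[_ ltxc].
  have lexl : x <= l by rewrite /l; lia.
  rewrite mem_cat; case: (gapset_compl G l x hG lG lexl) => [->//|lxG].
  by rewrite -[x](subKn lexl) (map_f (fun y => l - y) lxG) orbT.
have := uniq_leq_size (iota_uniq _ _) sub.
by rewrite size_iota size_cat size_map mul2n -addnn.
Qed.

Lemma gap_step_le_multiplicity (G : {fset nat}) (i : nat) :
  gapset G -> 1 <= i <= genus G - 1 -> gap G i.+1 - gap G i <= multiplicity G.
Proof.
move=> [_ addG] /andP[i_gt0 i_le]; rewrite leqNgt; apply/negP => lt_m.
have m_gt0 := multiplicity_gt0 G; have mG := multiplicity_notin G.
rewrite /gap /= in lt_m.
set s := sort leq G in lt_m.
have size_s : size s = genus G by rewrite size_sort.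
have mem_s : s =i G by move=> x; rewrite mem_sort.
set b := nth 0 s i in lt_m; set a := nth 0 s i.-1 in lt_m.
have bG : b \in G by rewrite -mem_s mem_nth // size_s; lia.
(* [lt_m] places [b - multiplicity G] strictly between [a] and [b], so it is positive. *)
have bmG : b - multiplicity G \in G.
  have []// := addG (multiplicity G) (b - multiplicity G) => //.
  - by lia.
  - by rewrite subnKC //; lia.
  - by rewrite (negPf mG).
rewrite -mem_s in bmG; set j := index (b - multiplicity G) s.
have j_lt : j < size s by rewrite index_mem.
have nth_j : nth 0 s j = b - multiplicity G by rewrite nth_index.
have nth_le := sorted_leq_nth leq_trans leqnn 0 (sort_sorted leq_total G).
rewrite -/s in nth_le.
(* [a] and [b] sit at the adjacent positions [i.-1] and [i], which leaves no index [j] for a value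
   strictly between them. *)
have [le_ji|lt_ij] := leqP j i.-1.
  have : nth 0 s j <= a by apply: nth_le; rewrite ?inE //; lia.
  by rewrite nth_j; lia.
have : b <= nth 0 s j by apply: nth_le; rewrite ?inE //; lia.
by rewrite nth_j; lia.
Qed.

Lemma pure_sparse_le_multiplicity (G : {fset nat}) (kappa : nat) :
  gapset G -> pure_sparse kappa G -> kappa <= multiplicity G.
Proof.
move=> hG [[_ ->]//|[_ ->]|[_ _ [i i_bd <-]]].
  exact: multiplicity_gt0.
exact: gap_step_le_multiplicity.
Qed.

Theorem proposition3p10 (G : {fset nat}) (kappa : nat)
  (hG : gapset G) (hkappa : pure_sparse kappa G)
  (hgenus : (2 * genus G <= 3 * kappa)%N) :
  (depth G <= 3)%R.
Proof.
have le_c := conductor_le_double_genus G hG.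
have le_k := pure_sparse_le_multiplicity G kappa hG hkappa.
rewrite /depth ceil_le_int ler_pdivrMr ?ltr0n ?multiplicity_gt0 //.
(* The two casts of 3 are convertible; the goal becomes [conductor G <= 3 * multiplicity G] in
   [nat]. *)
rewrite -[(3%:~R)%R]/(3%:R)%R -natrM ler_nat; lia.
Qed.
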